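(* Suppose that: 1. $\Gamma$ is a compact and convex subset of $\mathbb R^{d_\gamma}$. Further suppose that, for $P_{0,X}^{(\infty)}$-almost every fixed realization $\{x_i\}_{i\ge1}$ of $\{X_i\}_{i\ge1}$: 2. For every $n\ge1$ there exist a finite index set $\mathcal A_n$ and functions $\{q_{n,a}:a\in\mathcal A_n\}$ defined on $\Gamma^o\times\mathcal P$, where $\Gamma^o$ is an open set containing $\Gamma$, such that $Q_n(\gamma,p)=\max_{a\in\mathcal A_n}q_{n,a}(\gamma,p)$, and $q_{n,a}(\gamma,p)$ is differentiable and convex in $\gamma$ for each $p$, $a$ and $n$. 3. As $n\to\infty$, $$\Delta_n:=\sup_{(\gamma,p)\in\Gamma\times V_{n,\delta_n}}\max_{a\in\mathcal A_n}|q_{n,a}(\gamma,p)-q_{n,a}(\gamma,p_0)|\to0,$$ $$\Delta_n':=\sup_{(\gamma,p)\in\Gamma\times V_{n,\delta_n}}\max_{a\in\mathcal A_n}\|\nabla_\gamma q_{n,a}(\gamma,p)-\nabla_\gamma q_{n,a}(\gamma,p_0)\|_2\to0.$$ 4. $\gamma\mapsto\nabla_\gamma q_{n,a}(\gamma,p_0)$ is $L_0$-Lipschitz on $\Gamma$, where $L_0\in(0,\infty)$ is independent of $n$ and $a$, and there exist $\Gamma_{nbd}\subseteq\Gamma$ and $\breve N\ge1$ such that $\tilde\Gamma_{n,I}(p_0)\subseteq\Gamma_{nbd}$ for all $n\ge\breve N$ and $\sup_{n\ge\breve N}\sup_{\gamma\in\Gamma_{nbd}}\max_{a\in\mathcal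 A_n}\|\nabla_\gamma q_{n,a}(\gamma,p_0)\|_2<\infty$. 5. There exist $\eta>0$ and $\bar N\ge1$ such that, for all $n\ge\bar N$ and all $\tilde\gamma\in\tilde\Gamma_{n,I}(p_0)$, $$\{t\in\mathbb R^{d_\gamma}:\|t\|_2\le\eta\}\subseteq\mathrm{conv}\{\nabla_\gamma q_{n,a}(\tilde\gamma,p_0):a\in\mathcal A_n^*(\tilde\gamma,p_0)\},$$ where $\mathrm{conv}$ is the convex hull and $\mathcal A_n^*(\gamma,p)=\{a\in\mathcal A_n:q_{n,a}(\gamma,p)=Q_n(\gamma,p)\}$. Then, for $P_{0,X}^{(\infty)}$-almost every fixed realization $\{x_i\}_{i\ge1}$: (a) $\sup_{(\gamma,p)\in\Gamma\times V_{n,\delta_n}}|\tilde Q_n(\gamma,p)-\tilde Q_n(\gamma,p_0)|\to0$ as $n\to\infty$; (b) there exist a sequence $r_n\ge0$ with $r_n\to0$, constants $c,\zeta>0$, and an integer $\tilde N\ge1$ such that, for each $\gamma\in\Gamma$, $\tilde Q_n(\gamma,p)\ge c\cdot\mathrm{dist}(\gamma,\tilde\Gamma_{n,I}(p))^{\zeta}-r_n$ for all $p\in V_{n,\delta_n}$ and $n\ge\tilde N$; and consequently (c) for every $\varepsilon>0$ there exists $N\ge1$ such that $p\in V_{n,\delta_n}$ and $n\ge N$ imply $\tilde\Gamma_{n,I}(p)\cap B(\gamma,\varepsilon)\neq\emptyset$ for all $\gamma\in\tilde\Gamma_{n,I}(p_0)$.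
   Context: $\mathcal X\subseteq\mathbb R^{d_x}$; $\Delta^{K-1}$ is the probability simplex in $\mathbb R^K$; $\{X_i\}_{i\ge1}$ is a sequence of $\mathcal X$-valued random vectors with law $P_{0,X}^{(\infty)}$ and $\{x_i\}_{i\ge1}$ a fixed realization. $\mathcal P$ is a space of functions $p:\mathcal X\to\Delta^{K-1}$ (conditional PMFs) and $p_0\in\mathcal P$ is the true one. $f:\mathcal X\times\Delta^{K-1}\times\Gamma\to\mathbb R^{d_f}$ is a known function. $Q_n:\Gamma\times\mathcal P\to\mathbb R_+$ is a criterion function (may depend on $x_1,\dots,x_n$), depending on $p$ only through $(p(x_1),\dots,p(x_n))$, with $Q_n(\gamma,p)=0\iff f(x_i,p(x_i),\gamma)\in\mathbb R_+^{d_f}\ \forall i=1,\dots,n$. $\tilde Q_n(\gamma,p)=Q_n(\gamma,p)-\inf_{\tilde\gamma\in\Gamma}Q_n(\tilde\gamma,p)$ and $\tilde\Gamma_{n,I}(p)=\{\gamma\in\Gamma:\tilde Q_n(\gamma,p)=0\}$. For (possibly realization-dependent) sets $\mathcal P_n\subseteq\mathcal P$, semimetrics $d_n$ on $\mathcal P$ and $\delta_n\downarrow0$, $V_{n,\delta_n}=\mathcal P_n\cap\{p\in\mathcal P:d_n(p,p_0)<\delta_n\}$. $\mathrm{dist}$ is Euclidean distance to a set; $B(\gamma,\varepsilon)$ is the open Euclidean ball. *)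

(* Defs.v *)
From HB Require Import structures.
From mathcomp Require Import all_boot all_order all_algebra.
From mathcomp Require Import all_classical all_reals all_analysis.

Set Implicit Arguments.
Unset Strict Implicit.
Unset Printing Implicit Defensive.

Import Order.TTheory GRing.Theory Num.Theory.
Import numFieldNormedType.Exports.

Local Open Scope classical_set_scope.
Local Open Scope ring_scope.

Section euclidean.
Context {R : realType} {d : nat}.
Implicit Types (u v : 'rV[R]_d) (S : set 'rV[R]_d).

(* The library norm on 'rV[R]_d is the max norm: it yields the right topology
   and differentials, but metric quantities need the Euclidean norm. *)
Definition euclid u : R := Num.sqrt (\sum_(j < d) u 0 j ^+ 2).

(* Only meaningful for nonempty S, since [inf set0 = 0]. *)
Definition euclid_dist u S : R := inf [set euclid (u - v) | v in S].

Definition euclid_ball u (e : R) : set 'rV[R]_d := [set v | euclid (v - u) < e].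

Definition gradient (g : 'rV[R]_d -> R) u : 'rV[R]_d :=
  \row_(j < d) 'D_(delta_mx 0 j) g u.

Definition conv_hull S : set 'rV[R]_d := smallest (@convex_set R 'rV[R]_d) S.

Definition nonneg_orthant : set 'rV[R]_d := [set v | forall j, 0 <= v 0 j].

End euclidean.

Definition simplex (R : realType) (K : nat) : set 'rV[R]_K :=
  [set v | (forall j, 0 <= v 0 j) /\ \sum_(j < K) v 0 j = 1].
Arguments simplex : clear implicits.

(* Supremum in [0, +oo] of a family of nonnegative reals, so that the supremum
   of the empty family is 0 and that of an unbounded one is +oo. *)
Definition nnsup (R : realType) (I : Type) (D : set I) (g : I -> R) : \bar R :=
  ereal_sup ([set 0%E] `|` [set (g i)%:E | i in D]).

Section realizations.
Context {R : realType} {dx : nat} {XX : set 'rV[R]_dx}.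

(* [hX] only serves to make the type of sequences pointed, which the library
   requires of measurable types. *)
Definition sequences (hX : XX !=set0) : Type := nat -> XX.

Variable hX : XX !=set0.

HB.instance Definition _ := Choice.on (sequences hX).

Definition constant_sequence : sequences hX :=
  fun=> let: exist u Xu := cid hX in exist _ u (mem_set Xu).

HB.instance Definition _ := isPointed.Build (sequences hX) constant_sequence.

(* [cylinders] generates the product of the traces on XX of the Borel
   sigma-algebra of R^dx. The entry x i of a sequence stands for x_{i+1}. *)
Definition cylinders : set (set (sequences hX)) :=
  [set C | exists i j (B : set R),
     measurable B /\ C = [set x | B ((val (x i) : 'rV[R]_dx) 0 j)]].

End realizations.
Arguments cylinders {R dx XX} hX.

Definition semimetric_on (R : realType) (T : Type) (S : set T) (m : T -> T -> R) :=
  [/\ forall p, S p -> m p p = 0,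
      forall p p', S p -> S p' -> 0 <= m p p',
      forall p p', S p -> S p' -> m p p' = m p' p &
      forall p p' p'', S p -> S p' -> S p'' -> m p p'' <= m p p' + m p' p''].

Section criterion.
Context {R : realType} {T U : Type}.
Variables (G : set U) (Q : U -> T -> R).

Definition excess (g : U) (p : T) : R := Q g p - inf [set Q t p | t in G].

Definition argmin_set (p : T) : set U := [set g | G g /\ excess g p = 0].

End criterion.

Definition local_nbhd (R : realType) (T : Type) (Pn : set T) (m : T -> T -> R)
  (p0 : T) (delta : R) : set T := Pn `&` [set p | m p p0 < delta].

(* Main.v *)
(* The criterion at p0 is a maximum of convex functions, so at a minimizer s0
   the subgradient inequalities give <v, g - s0> <= Q(g, p0) - Q(s0, p0) for every v
   in the convex hull of the active gradients. This hull contains the ball of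
   radius eta; taking v = eta (g - s0) / |g - s0| yields the sharp growth
   eta |g - s0| <= Q(g, p0) - Q(s0, p0). Since Q(., p) is uniformly within
   Delta_n of Q(., p0), the excess criteria are within 2 Delta_n of each other,
   and the minimizers under p lie within 2 Delta_n / eta of s0. The growth bound
   thus holds for p with c = eta, zeta = 1 and r_n = 4 Delta_n. *)
Require Import Defs.
From HB Require Import structures.
From mathcomp Require Import all_boot all_order all_algebra.
From mathcomp Require Import all_classical all_reals all_analysis.
From mathcomp Require Import lra.

Set Implicit Arguments.
Unset Strict Implicit.
Unset Printing Implicit Defensive.

Import Order.TTheory GRing.Theory Num.Theory.
Import numFieldNormedType.Exports.

Local Open Scope classical_set_scope.
Local Open Scope ring_scope.

(** * Euclidean geometry, convex hulls and gradients of convex functions *)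

Section euclidean_space.
Context {R : realType} {d : nat}.
Implicit Types u v w : 'rV[R]_d.

Definition dotv u v : R := \sum_(j < d) u 0 j * v 0 j.

Lemma dotvDl u v w : dotv (u + v) w = dotv u w + dotv v w.
Proof.
by rewrite /dotv -big_split; apply: eq_bigr => j _; rewrite mxE mulrDl.
Qed.

Lemma dotvZl (k : R) u v : dotv (k *: u) v = k * dotv u v.
Proof.
by rewrite /dotv mulr_sumr; apply: eq_bigr => j _; rewrite mxE mulrA.
Qed.

Lemma dotvC u v : dotv u v = dotv v u.
Proof. by apply: eq_bigr => j _; rewrite mulrC. Qed.

Lemma dotvv_ge0 u : 0 <= dotv u u.
Proof. by apply: sumr_ge0 => j _; rewrite -expr2 sqr_ge0. Qed.

Lemma euclid_ge0 u : 0 <= euclid u.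
Proof. exact: sqrtr_ge0. Qed.

Lemma sqr_euclid u : euclid u ^+ 2 = dotv u u.
Proof.
have -> : dotv u u = \sum_(j < d) u 0 j ^+ 2 by apply: eq_bigr.
by rewrite sqr_sqrtr// sumr_ge0// => j _; rewrite sqr_ge0.
Qed.

Lemma euclidZ (k : R) u : euclid (k *: u) = `|k| * euclid u.
Proof.
apply/eqP; rewrite -(eqrXn2 (n := 2))// ?mulr_ge0 ?euclid_ge0//.
by rewrite exprMn !sqr_euclid real_normK ?num_real// dotvZl dotvC dotvZl mulrA.
Qed.

(** Cauchy-Schwarz: with a, b the norms of u, v, the square of b u - a v expands to 2ab(ab - <u, v>)
    >= 0, and ab > 0 is cancelled. If ab = 0, one vector has only zero coordinates. *)
Lemma dotv_le u v : dotv u v <= euclid u * euclid v.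
Proof.
have [/eqP|ab0] := eqVneq (euclid u * euclid v) 0; last first.
  have ab_gt0 : 0 < euclid u * euclid v.
    by rewrite lt_def ab0 mulr_ge0// euclid_ge0.
  have := dotvv_ge0 (euclid v *: u + (- euclid u) *: v).
  rewrite dotvDl !dotvZl !(dotvC _ (_ + _)) !dotvDl !dotvZl (dotvC v u).
  rewrite -!sqr_euclid => h.
  rewrite -subr_ge0 -(pmulr_rge0 _ ab_gt0); nra.
rewrite mulf_eq0.
have dot0 a b : euclid a == 0 -> dotv a b = 0.
  move=> /eqP a0; apply: big1 => j _.
  suff -> : a 0 j = 0 by rewrite mul0r.
  apply/eqP; rewrite -sqrf_eq0 eq_le sqr_ge0 andbT.
  have <- : dotv a a = 0 by rewrite -sqr_euclid a0 expr0n.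
  rewrite /dotv (bigD1 j)//= -expr2 lerDl sumr_ge0// => i _.
  by rewrite -expr2 sqr_ge0.
have ge0 : 0 <= euclid u * euclid v by rewrite mulr_ge0 ?euclid_ge0.
by case/orP => h; [rewrite dot0|rewrite dotvC dot0].
Qed.

Lemma ler_euclidD u v : euclid (u + v) <= euclid u + euclid v.
Proof.
rewrite -(ler_pXn2r (n := 2))// ?nnegrE ?addr_ge0 ?euclid_ge0//.
rewrite sqrrD !sqr_euclid dotvDl !(dotvC _ (_ + _)) !dotvDl (dotvC v u).
have := dotv_le u v; lra.
Qed.

Lemma euclidC u v : euclid (u - v) = euclid (v - u).
Proof. by rewrite -[u - v]opprB -scaleN1r euclidZ normrN1 mul1r. Qed.

Lemma euclid_dist_le u v (S : set 'rV[R]_d) : S v ->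
  euclid_dist u S <= euclid (u - v).
Proof.
move=> Sv; apply: ge_inf; last by exists v.
by exists 0 => _ [w _ <-]; exact: euclid_ge0.
Qed.

Lemma euclid_dist_ge0 u (S : set 'rV[R]_d) : S !=set0 -> 0 <= euclid_dist u S.
Proof.
move=> [v Sv]; apply: lb_le_inf; first by exists (euclid (u - v)), v.
by move=> _ [w _ <-]; exact: euclid_ge0.
Qed.

(** The half-space of all t with <t, v> <= M is convex and contains S, hence contains the smallest
    convex set around S. *)
Lemma conv_hull_dotv_le (S : set 'rV[R]_d) v M :
  (forall u, S u -> dotv u v <= M) -> forall t, conv_hull S t -> dotv t v <= M.
Proof.
move=> SM; apply: smallest_sub; last exact: SM.
move=> a b k; rewrite !inE => aM bM /=.
rewrite dotvDl !dotvZl.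
have k0 : 0 <= k%:num by [].
have k1 : k%:num <= 1 by [].
have := ler_wpM2l k0 aM.
have k1' : 0 <= 1 - k%:num by rewrite subr_ge0.
have := ler_wpM2l k1' bM; rewrite /unstable.onem; lra.
Qed.

Lemma gradient_dotv (f : 'rV[R]_d -> R) u v : differentiable f u ->
  dotv (gradient f u) v = 'D_v f u.
Proof.
move=> df; rewrite deriveE// {2}(row_sum_delta v) linear_sum.
by apply: eq_bigr => j _; rewrite linearZ mxE deriveE// mulrC.
Qed.

(** By convexity the difference quotient along v - u at any step 0 < h <= 1 is at most the full
    chord f v - f u; let h tend to 0 from the right. *)
Lemma convex_gradient_le (C : set 'rV[R]_d) (f : 'rV[R]_d -> R) u v :
  convex_function C f -> C u -> C v -> differentiable f u ->
  dotv (gradient f u) (v - u) <= f v - f u.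
Proof.
move=> cf Cu Cv df; rewrite gradient_dotv//.
pose g h := h^-1 *: ((f \o shift u) (h *: (v - u)) - f u).
have cvg_g : cvg (g @ 0^') by exact: diff_derivable.
rewrite /derive -/g cvg_at_rightE//; apply: limr_le.
  by move/cvg_dnbhs_at_right : cvg_g => /cvgP.
rewrite /g; near=> h => /=.
have h0 : 0 < h by near: h; exact: nbhs_right_gt.
have h1 : h <= 1 by near: h; exact: nbhs_right_le.
have := cf (Itv01 (ltW h0) h1) v u (mem_set Cv) (mem_set Cu).
have -> : (h *: (v - u) + u) = h *: v + (1 - h) *: u.
  by rewrite scalerBr scalerBl scale1r -addrA (addrC u).
move=> cfh; rewrite -ler_pdivlMl ?invr_gt0// invrK.
apply: le_trans (lerB cfh (lexx _)) _ => /=.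
rewrite convRE /= /unstable.onem; lra.
Unshelve. all: by end_near. Qed.

End euclidean_space.

(** * Finite maxima: attainment and stability *)

Section finite_maximum.
Context {R : realType} {A : finType}.
Implicit Types F : A -> R.

(** The initial value -oo is strictly below the real y, so if every F a were below y the maximum
    would be too. In particular A is nonempty. *)
Lemma bigmaxe_attained F y : y%:E = \big[maxe/-oo%E]_(a : A) (F a)%:E ->
  (forall a, F a <= y) /\ exists a, F a = y.
Proof.
move=> yE; have F_le a : F a <= y by rewrite -lee_fin yE; exact: le_bigmax.
split=> //; apply: contrapT => /forallNP Fy.
suff : (y%:E < y%:E)%E by rewrite ltxx.
rewrite {1}yE; apply: bigmax_lt => [|a _]; first exact: ltNyr.
by rewrite lte_fin lt_neqAle F_le andbT; apply/eqP.
Qed.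

Lemma bigmaxe_dist_le F F' y y' (D : R) :
  y%:E = \big[maxe/-oo%E]_(a : A) (F a)%:E ->
  y'%:E = \big[maxe/-oo%E]_(a : A) (F' a)%:E ->
  (forall a, `|F a - F' a| <= D) -> `|y - y'| <= D.
Proof.
move=> /bigmaxe_attained[Fy [a ya]] /bigmaxe_attained[F'y [b yb]] FF'.
(* An index attaining either maximum competes in the other one. *)
move: (FF' a) (FF' b) (Fy b) (F'y a); rewrite !ler_norml ya yb.
by move=> /andP[? ?] /andP[? ?] ? ?; apply/andP; split; lra.
Qed.

End finite_maximum.

(** * Minimizing a finite maximum: existence and sharp growth *)

Section minimum.
Context {R : realType} {d : nat} {A : finType}.
Variables (G : set 'rV[R]_d) (q : A -> 'rV[R]_d -> R) (Q : 'rV[R]_d -> R).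
Hypothesis q_diff : forall a g, G g -> differentiable (q a) g.
Hypothesis QE : forall g, G g ->
  (Q g)%:E = \big[maxe/-oo%E]_(a : A) (q a g)%:E.

Lemma max_attains_min : G !=set0 -> compact G -> (forall g, G g -> 0 <= Q g) ->
  exists2 s, G s & forall g, G g -> Q s <= Q g.
Proof.
move=> G0 cG Q0.
(* Starting the maximum at 0 is harmless since [Q >= 0]. *)
pose M g := \big[Num.max/0]_(a : A) q a g.
have QM g : G g -> Q g = M g.
  move=> Gg; have [q_le [a qa]] := bigmaxe_attained (QE Gg).
  apply/eqP; rewrite eq_le; apply/andP.
  split; last exact: bigmax_le (Q0 _ Gg) _.
  by rewrite -qa; exact: le_bigmax.
have cM : {within G, continuous M}.
  apply: (continuous_big) => [|a _].
    exact: max_continuous.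
  apply: continuous_in_subspaceT => g /set_mem Gg.
  exact/differentiable_continuous/q_diff.
have [s /set_mem Gs sM] := compact_EVT_min G0 cG cM.
by exists s => // g Gg; rewrite !QM//; exact/sM/mem_set.
Qed.

Lemma sharp_minimum (s : 'rV[R]_d) (eta : R) :
  (forall a, convex_function G (q a)) -> G s ->
  [set t | euclid t <= eta] `<=`
    conv_hull [set gradient (q a) s | a in [set a | q a s = Q s]] -> 0 <= eta ->
  forall g, G g -> eta * euclid (g - s) <= Q g - Q s.
Proof.
move=> cq Gs ball_sub eta0 g Gg; set w := g - s.
have dotv_active v : conv_hull
    [set gradient (q a) s | a in [set a | q a s = Q s]] v ->
    dotv v w <= Q g - Q s.
  apply: conv_hull_dotv_le => _ [a /= qas <-].
  apply: le_trans (convex_gradient_le (cq a) Gs Gg (q_diff a Gs)) _.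
  by rewrite qas lerB// (bigmaxe_attained (QE Gg)).1.
(* The direction w cannot be normalized when its norm is 0; the zero vector of the ball then
   suffices. *)
have [w0|w0] := eqVneq (euclid w) 0.
  have := dotv_active 0; rewrite w0 mulr0 -(scale0r w) dotvZl mul0r; apply.
  by apply: ball_sub; rewrite /= euclidZ w0 mulr0.
have := dotv_active ((eta / euclid w) *: w).
rewrite dotvZl -sqr_euclid expr2 mulrA divfK//; apply.
apply: ball_sub; rewrite /= euclidZ ger0_norm ?divr_ge0 ?euclid_ge0//.
by rewrite divfK.
Qed.

End minimum.

(** * The excess criterion and its stability under perturbation *)

Section excess.
Context {R : realType} {T : Type} {d : nat}.
Variables (G : set 'rV[R]_d) (Q : 'rV[R]_d -> T -> R).

Lemma excess_min s p : G s -> (forall g, G g -> Q s p <= Q g p) ->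
  forall g, excess G Q g p = Q g p - Q s p.
Proof.
move=> Gs sQ g; congr (_ - _); apply/eqP; rewrite eq_le; apply/andP; split.
  by apply: ge_inf; [exists (Q s p) => _ [t Gt <-]; exact: sQ|exists s].
by apply: lb_le_inf; [exists (Q s p), s|move=> _ [t Gt <-]; exact: sQ].
Qed.

Lemma argmin_setE s p : G s -> (forall g, G g -> Q s p <= Q g p) ->
  argmin_set G Q p s.
Proof. by move=> Gs sQ; split; rewrite ?(excess_min Gs)// subrr. Qed.

(** Nonnegativity bounds the values below, so that [inf] is a true lower bound and not a default
    value. *)
Lemma argmin_set_le s p : (forall g, G g -> 0 <= Q g p) ->
  argmin_set G Q p s -> G s /\ forall g, G g -> Q s p <= Q g p.
Proof.
move=> Q0 [Gs /eqP]; rewrite subr_eq0 => /eqP QsE; split=> // g Gg.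
by rewrite QsE; apply: ge_inf; [exists 0 => _ [t Gt <-]; exact: Q0|exists g].
Qed.

(** One D comes from the criterion at g, the other from the minimal values: each minimizer competes
    in the other problem, so these differ by at most D. *)
Lemma excess_dist_le (p p0 : T) s s0 (D : R) :
  argmin_set G Q p s -> argmin_set G Q p0 s0 ->
  (forall g, G g -> 0 <= Q g p) -> (forall g, G g -> 0 <= Q g p0) ->
  (forall g, G g -> `|Q g p - Q g p0| <= D) ->
  forall g, G g -> `|excess G Q g p - excess G Q g p0| <= 2 * D.
Proof.
move=> min_s min_s0 Qp Qp0 QD g Gg.
have [[Gs sQ] [Gs0 s0Q]] := (argmin_set_le Qp min_s, argmin_set_le Qp0 min_s0).
rewrite (excess_min Gs sQ) (excess_min Gs0 s0Q).
move: (QD _ Gg) (QD _ Gs) (QD _ Gs0) (sQ _ Gs0) (s0Q _ Gs).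
rewrite !ler_norml => /andP[? ?] /andP[? ?] /andP[? ?] ? ?.
by apply/andP; split; lra.
Qed.

(* A minimizer [s] of the perturbed criterion has excess at most [2 D] under
   [p0], so the sharp growth at [s0] puts it within [2 D / eta] of [s0]. *)
Lemma excess_growth (p p0 : T) s s0 (D eta : R) :
  argmin_set G Q p s -> 0 < eta ->
  (forall g, G g -> eta * euclid (g - s0) <= excess G Q g p0) ->
  (forall g, G g -> `|excess G Q g p - excess G Q g p0| <= 2 * D) ->
  eta * euclid (s - s0) <= 2 * D /\
  forall g, G g ->
    eta * euclid_dist g (argmin_set G Q p) - 4 * D <= excess G Q g p.
Proof.
move=> argmin_s eta0 sharp eD; have [Gs es] := argmin_s.
have s_near : eta * euclid (s - s0) <= 2 * D.
  move: (sharp _ Gs) (eD _ Gs); rewrite es ler_norml => ? /andP[? ?]; lra.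
split=> // g Gg.
have dist_le : euclid_dist g (argmin_set G Q p) <=
    euclid (g - s0) + euclid (s - s0).
  apply: le_trans (euclid_dist_le g argmin_s) _.
  by rewrite (euclidC s) -(subrKA s0 g (- s)) ler_euclidD.
(* The loss 4 D adds 2 D for passing from p0 to p in the excess at g and 2 D for moving from s0 to
   s. *)
move: (sharp _ Gg) (eD _ Gg) (ler_wpM2l (ltW eta0) dist_le).
by rewrite mulrDr ler_norml => ? /andP[? ?] ?; lra.
Qed.

End excess.

(** * Bounds on suprema in [0, +oo] *)

Section nnsup_lemmas.
Context {R : realType} {I : Type}.
Implicit Types (D : set I) (g : I -> R).

Lemma nnsup_ge0 D g : (0 <= nnsup D g)%E.
Proof. by apply: ereal_sup_ubound; left. Qed.

Lemma nnsup_ubound D g i : D i -> ((g i)%:E <= nnsup D g)%E.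
Proof. by move=> Di; apply: ereal_sup_ubound; right; exists i. Qed.

Lemma nnsup_le D g (M : R) : 0 <= M -> (forall i, D i -> g i <= M) ->
  (nnsup D g <= M%:E)%E.
Proof.
by move=> M0 gM; apply: ge_ereal_sup => _ [->|[i Di <-]]; rewrite lee_fin// gM.
Qed.

End nnsup_lemmas.

Theorem proposition6 (R : realType) (dx K dg df : nat)
    (XX : set 'rV[R]_dx) (hX : XX !=set0)
    (disp : measure_display) (Omega : measurableType disp)
    (Pr : probability Omega R) (X : {RV Pr >-> g_sigma_algebraType (cylinders hX)})
    (PP : set (XX -> simplex R K)) (p0 : XX -> simplex R K) (hp0 : PP p0)
    (Gamma : set 'rV[R]_dg)
    (f : XX -> simplex R K -> 'rV[R]_dg -> 'rV[R]_df)
    (Q : (nat -> XX) -> nat -> 'rV[R]_dg -> (XX -> simplex R K) -> R)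
    (Q_ge0 : forall x n g p, (0 < n)%N -> Gamma g -> PP p -> 0 <= Q x n g p)
    (Q_sample : forall x x' n g p, (0 < n)%N -> Gamma g -> PP p ->
      (forall i, (i < n)%N -> x i = x' i) -> Q x n g p = Q x' n g p)
    (Q_pmf : forall x n g p p', (0 < n)%N -> Gamma g -> PP p -> PP p' ->
      (forall i, (i < n)%N -> p (x i) = p' (x i)) -> Q x n g p = Q x n g p')
    (Q_eq0 : forall x n g p, (0 < n)%N -> Gamma g -> PP p ->
      Q x n g p = 0 <->
      forall i, (i < n)%N -> nonneg_orthant (f (x i) (p (x i)) g))
    (Pn : (nat -> XX) -> nat -> set (XX -> simplex R K))
    (Pn_sub : forall x n, (0 < n)%N -> Pn x n `<=` PP)
    (m : (nat -> XX) -> nat -> (XX -> simplex R K) -> (XX -> simplex R K) -> R)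
    (m_semimetric : forall x n, (0 < n)%N -> semimetric_on PP (m x n))
    (delta : (nat -> XX) -> nat -> R)
    (delta_noninc : forall x k n, (0 < k)%N -> (k <= n)%N ->
      delta x n <= delta x k)
    (delta_cvg0 : forall x, delta x @ \oo --> (0 : R))
    (V := fun x n => local_nbhd (Pn x n) (m x n) p0 (delta x n))
    (tQ := fun x n => excess Gamma (Q x n))
    (tGamma := fun x n => argmin_set Gamma (Q x n)) :
  (* 1 *)
  compact Gamma -> convex_set Gamma ->
  {ae distribution Pr X, forall x : g_sigma_algebraType (cylinders hX),
    exists (A : nat -> finType)
           (q : forall n, A n -> 'rV[R]_dg -> (XX -> simplex R K) -> R),
    [/\ (* 2 *)
        forall n, (0 < n)%N -> exists Go : set 'rV[R]_dg,
          [/\ open Go, Gamma `<=` Go,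
              forall g p, Gamma g -> PP p ->
                (Q x n g p)%:E = \big[maxe/-oo%E]_(a : A n) (q n a g p)%:E,
              forall a g p, Go g -> PP p -> differentiable (q n a ^~ p) g &
              forall a p (C : set 'rV[R]_dg), PP p -> convex_set C ->
                C `<=` Go -> convex_function C (q n a ^~ p)],
        (* 3 *)
        nnsup (Gamma `*` V x n) (fun gp => \big[Num.max/0]_(a : A n)
          `|q n a gp.1 gp.2 - q n a gp.1 p0|) @[n --> \oo] --> 0%E /\
        nnsup (Gamma `*` V x n) (fun gp => \big[Num.max/0]_(a : A n)
          euclid (gradient (q n a ^~ gp.2) gp.1 - gradient (q n a ^~ p0) gp.1))
          @[n --> \oo] --> 0%E,
        (* 4 *)
        (exists L0 : R, 0 < L0 /\
          forall n (a : A n) g g', (0 < n)%N -> Gamma g -> Gamma g' ->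
            euclid (gradient (q n a ^~ p0) g - gradient (q n a ^~ p0) g')
              <= L0 * euclid (g - g')) /\
        (exists (Gnbd : set 'rV[R]_dg) (N : nat),
          [/\ Gnbd `<=` Gamma, (0 < N)%N,
              forall n, (N <= n)%N -> tGamma x n p0 `<=` Gnbd &
              (nnsup [set ng : nat * 'rV[R]_dg | (N <= ng.1)%N /\ Gnbd ng.2]
                (fun ng => (\big[Num.max/0]_(a : A ng.1)
                   euclid (gradient (q ng.1 a ^~ p0) ng.2))%R) < +oo)%E]) &
        (* 5 *)
        exists (eta : R) (N : nat),
          [/\ 0 < eta, (0 < N)%N &
              forall n g, (N <= n)%N -> tGamma x n p0 g ->
                [set t : 'rV[R]_dg | euclid t <= eta] `<=`
                conv_hull [set gradient (q n a ^~ p0) g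
                          | a in [set a : A n | q n a g p0 = Q x n g p0]]]]} ->
  {ae distribution Pr X, forall x : g_sigma_algebraType (cylinders hX),
    [/\ (* (a) *)
        nnsup (Gamma `*` V x n)
          (fun gp => `|tQ x n gp.1 gp.2 - tQ x n gp.1 p0|) @[n --> \oo] --> 0%E,
        (* (b) *)
        exists (r : nat -> R) (c zeta : R) (N : nat),
          [/\ (forall n, 0 <= r n) /\ r @ \oo --> (0 : R),
              0 < c, 0 < zeta, (0 < N)%N &
              forall g, Gamma g -> forall n p, (N <= n)%N -> V x n p ->
                c * (euclid_dist g (tGamma x n p)) `^ zeta - r n
                  <= tQ x n g p] &
        (* (c) *)
        forall e : R, 0 < e -> exists N : nat, (0 < N)%N /\
          forall n p, (N <= n)%N -> V x n p ->
            forall g, tGamma x n p0 g ->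
              (tGamma x n p `&` euclid_ball g e) !=set0]}.
Proof.
(* The argument is pathwise: the conclusion holds at every realization satisfying the
   assumptions. *)
move=> cG convG; apply: filterS => x.
move=> [A [q [qQ [Delta_cvg _] _ [eta [N5 [eta0 N5_gt0 ball5]]]]]].
set Delta := (X in X @ _ --> _) in Delta_cvg.
(* Delta may be +oo for small n; convergence to 0 makes it eventually finite, and its real part [u]
   serves as the uniform error. *)
have /fine_cvgP[Delta_fin u_cvg] := Delta_cvg.
pose u n := fine (Delta n).
have u_ge0 n : 0 <= u n by rewrite fine_ge0// nnsup_ge0.
have VPP n p : (0 < n)%N -> V x n p -> PP p by move=> n0 [/(Pn_sub _ _ n0)].
have QD n p : (0 < n)%N -> Delta n \is a fin_num -> V x n p ->
    forall g, Gamma g -> `|Q x n g p - Q x n g p0| <= u n.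
  move=> n0 Dfin Vp g Gg; have [Go [_ _ QE _ _]] := qQ n n0.
  apply: bigmaxe_dist_le (QE g p Gg (VPP n p n0 Vp)) (QE g p0 Gg hp0) _ => a.
  rewrite -lee_fin fineK//.
  apply: le_trans; last exact: (@nnsup_ubound _ _ _ _ (g, p)).
  by rewrite lee_fin; apply: (le_bigmax _ (fun a => `|q n a g p - q n a g p0|)).
have min_ex n p g : (0 < n)%N -> PP p -> Gamma g -> exists s, tGamma x n p s.
  move=> n0 PPp Gg; have [Go [_ GGo QE q_diff _]] := qQ n n0.
  have [s Gs sQ] : exists2 s, Gamma s &
      forall g, Gamma g -> Q x n s p <= Q x n g p.
    apply: (max_attains_min (q := fun a g => q n a g p)) => //.
    - by move=> a h Gh; apply: q_diff => //; exact: GGo.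
    - by move=> h Gh; exact: QE.
    - by exists g.
    - by move=> h Gh; exact: Q_ge0.
  by exists s; exact: argmin_setE.
have tQD n p : (0 < n)%N -> Delta n \is a fin_num -> V x n p ->
    forall g, Gamma g -> `|tQ x n g p - tQ x n g p0| <= 2 * u n.
  move=> n0 Dfin Vp g Gg; have PPp := VPP n p n0 Vp.
  have [s min_s] := min_ex n p g n0 PPp Gg.
  have [s0 min_s0] := min_ex n p0 g n0 hp0 Gg.
  apply: (excess_dist_le min_s min_s0) => // h Gh;
    [exact: Q_ge0|exact: Q_ge0|exact: QD].
have sharp n s0 : (0 < n)%N -> (N5 <= n)%N -> tGamma x n p0 s0 ->
    forall g, Gamma g -> eta * euclid (g - s0) <= tQ x n g p0.
  move=> n0 N5n min_s0 g Gg; have [Go [_ GGo QE q_diff q_conv]] := qQ n n0.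
  have [Gs0 s0Q] :=
    argmin_set_le (fun h Gh => Q_ge0 x n h p0 n0 Gh hp0) min_s0.
  rewrite /tQ (excess_min Gs0 s0Q).
  have qd a h : Gamma h -> differentiable (q n a ^~ p0) h.
    by move=> Gh; apply: q_diff => //; exact: GGo.
  have qc a : convex_function Gamma (q n a ^~ p0) by exact: q_conv.
  exact: (sharp_minimum (q := fun a h => q n a h p0) qd
    (fun h Gh => QE h p0 Gh hp0) qc Gs0 (ball5 n s0 N5n min_s0) (ltW eta0)).
(* Perturbed growth with D = [u n], shared by (b) and (c): its first half places s near s0, its
   second is the error bound. *)
have growth n p s s0 : (0 < n)%N -> (N5 <= n)%N -> Delta n \is a fin_num ->
    V x n p -> tGamma x n p s -> tGamma x n p0 s0 -> _ :=
  fun n0 N5n Dfin Vp min_s min_s0 => excess_growth min_s eta0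
    (sharp n s0 n0 N5n min_s0) (tQD n p n0 Dfin Vp).
split.
- apply: (squeeze_cvge (f := fun=> 0%E) (h := fun n => (2 * u n)%:E)).
  + near=> n; rewrite nnsup_ge0/=; apply: nnsup_le => [|[g p] [/= Gg Vp]].
      by rewrite mulr_ge0.
    (* The assumptions concern n >= 1 only, so index 0 is discarded. *)
    apply: tQD => //; first by near: n; exists 1.
    by near: n.
  + exact: cvg_cst.
  + apply: cvg_EFin; first by near=> n.
    by rewrite -[0](mulr0 2); apply: cvgMr; exact: u_cvg.
- have [Nf _ Nf_fin] := Delta_fin.
  exists (fun n => 4 * u n), eta, 1, (maxn Nf N5); split=> //.
  + split=> [n|]; first by rewrite mulr_ge0.
    by rewrite -[0](mulr0 4); apply: cvgMr; exact: u_cvg.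
  + by rewrite leq_max N5_gt0 orbT.
  + move=> g Gg n p; rewrite geq_max => /andP[Nfn N5n] Vp.
    have n0 := leq_trans N5_gt0 N5n; have PPp := VPP n p n0 Vp.
    have [s min_s] := min_ex n p g n0 PPp Gg.
    have [s0 min_s0] := min_ex n p0 g n0 hp0 Gg.
    (* Exponent 1 disappears only for a nonnegative base, hence the need for a minimizer under p. *)
    rewrite powRr1; last by apply: euclid_dist_ge0; exists s.
    exact: (growth n p s s0 n0 N5n (Nf_fin n Nfn) Vp min_s min_s0).2.
- move=> e e0.
  (* This threshold makes the radius 2 [u n] / eta smaller than e. The given minimizer g under p0
     then takes the place of s0. *)
  have : \forall n \near \oo, u n < eta * e / 2.
    by apply: cvgr_lt u_cvg _ _; rewrite divr_gt0// mulr_gt0.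
  move=> [Nu _ Nu_lt]; have [Nf _ Nf_fin] := Delta_fin.
  exists (maxn (maxn Nf Nu) N5); split; first by rewrite leq_max N5_gt0 orbT.
  move=> n p; rewrite !geq_max => /andP[/andP[Nfn Nun] N5n] Vp g min_g.
  have n0 := leq_trans N5_gt0 N5n; have PPp := VPP n p n0 Vp.
  have [s min_s] := min_ex n p g n0 PPp min_g.1.
  exists s; split=> //; rewrite /euclid_ball /= -(ltr_pM2l eta0).
  have [+ _] := growth n p s g n0 N5n (Nf_fin n Nfn) Vp min_s min_g.
  have := Nu_lt n Nun; rewrite /=; lra.
Unshelve. all: by end_near. Qed.
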